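(* Let $p=p(n)\in[0,1]$ satisfy $p>(\ln n+\ln\ln n+g(n))/n$ where $g(n)=\omega(1)$. Then the random graph $G_{n,p}$ is neighborhood-prime with high probability.
   Context: All graphs are finite and simple; $[n]=\{1,\dots,n\}$; $N(v)$ is the set of neighbors of $v$. A neighborhood-prime labeling of a graph $G$ of order $n$ is a bijection $f:V(G)\to[n]$ such that for every vertex $v$ of degree greater than $1$, $\gcd\{f(u):u\in N(v)\}=1$; a graph is neighborhood-prime if it has such a labeling. $G_{n,p}$ is the random graph on $n$ vertices in which each of the $\binom n2$ possible edges is present independently with probability $p$. ''With high probability'' means with probability tending to $1$ as $n\to\infty$. $g(n)=\omega(1)$ means $g(n)\to\infty$ as $n\to\infty$. *)

(* Defs.v *)
From HB Require Import structures.
From mathcomp Require Import all_boot all_order all_algebra.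
From mathcomp Require Import all_classical all_reals all_analysis.

Set Implicit Arguments.
Unset Strict Implicit.
Unset Printing Implicit Defensive.

Import Order.TTheory GRing.Theory Num.Theory.
Import numFieldNormedType.Exports.

Local Open Scope set_scope.
Local Open Scope ring_scope.

(* A finite simple graph on T is its set of edges, an edge being a
   two-element set of vertices. *)
Record sgraph (T : finType) := SGraph {
  edges : {set {set T}};
  edges_card2 : [forall e in edges, #|e| == 2%N]
}.

HB.instance Definition _ (T : finType) := [isSub for @edges T].
HB.instance Definition _ (T : finType) := [Finite of sgraph T by <:].

Section NeighborhoodPrime.
Variables (T : finType) (G : sgraph T).

Definition nbhd (v : T) : {set T} := [set u | [set u; v] \in edges G].

Definition degree (v : T) : nat := #|nbhd v|.

(* The first two clauses say that f is a bijection from T onto {1, ..., #|T|}. *)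
Definition neighborhood_prime_labeling (f : T -> nat) : Prop :=
  [/\ injective f,
      forall k : nat, (1 <= k <= #|T|)%N <-> exists v, f v = k
    & forall v, (1 < degree v)%N ->
        \big[gcdn/0%N]_(u in nbhd v) f u = 1%N].

Definition neighborhood_prime : Prop :=
  exists f : T -> nat, neighborhood_prime_labeling f.

End NeighborhoodPrime.

Section RandomGraph.
Variables (R : realType) (n : nat) (p : R).

(* The law of G_{n,p}: the product, over the 'C(n, 2) possible edges, of
   Bernoulli laws of parameter p. *)
Definition gnp_weight (G : sgraph 'I_n) : R :=
  \prod_(e : {set 'I_n} | #|e| == 2%N) (if e \in edges G then p else 1 - p).

Definition gnp_prob (A : sgraph 'I_n -> Prop) : R :=
  \sum_(G : sgraph 'I_n | `[< A G >]) gnp_weight G.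

End RandomGraph.

(* Main.v *)
Require Import Defs.
From HB Require Import structures.
From mathcomp Require Import all_boot all_order all_algebra.
From mathcomp Require Import all_classical all_reals all_analysis.
From mathcomp Require Import perm zify ring lra.

(** No Hamilton cycle is needed: a labeling fixed in advance works for all but
    few vertices, and a small set of primes repairs the others.

    Give vertex [i] of ['I_n] the label [i.+1], and set aside a set [P],
    of order [n / ln n], of vertices carrying large primes.  Call reserved the vertices
    whose label is 1 or a multiple of a prime of [P]; there are at most
    [1 + n / 24] of them ([reserve_primes], which rests on the lower bound
    [chebyshev] for the number of primes).  Call a vertex of degree at least 2
    bad if the labels of its non-reserved neighbors do not have gcd 1.

    If [2 * #|bad| <= #|P|], the labeling can be repaired
    ([neighborhood_prime_few_bad]).  Choose two neighbors of every bad vertex,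
    let [U] be the set of chosen vertices, and permute the labels within the
    union of [U] and [P] so that all of [U] gets primes of [P].  A bad vertex
    now sees two distinct primes.  A vertex that is not bad and sees no vertex
    of [U] keeps its non-reserved neighbors, hence gcd 1.  If it does see some
    vertex of [U], carrying the prime [q], it also has a second non-reserved
    neighbor, since a single one would need the reserved label 1; that neighbor
    carries either another prime of [P] or its old label, which [q] does not
    divide.

    If [v] is bad, then either it has no non-reserved neighbor at all, or it has
    one, [w], and some prime [q] dividing the label of [w] divides the labels
    of all of them.  In both cases [v] misses at least [n / 3] prescribed
    vertices when [n] is large, an event of probability at most
    [exp (- n p / 3)].  There are at most [n] choices of [w], each adjacent to
    [v] with probability [p], and about [ln n] choices of [q], so the expected
    number of bad vertices is at most of order
    [n exp (- n p / 3) (1 + n p ln n)].  When [n p >= ln n] this is [n^(2/3)]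
    up to logarithmic factors, far below [#|P|], and Markov's inequality
    concludes. *)

Set Implicit Arguments.
Unset Strict Implicit.
Unset Printing Implicit Defensive.

Import Order.TTheory GRing.Theory Num.Theory.
Import numFieldNormedType.Exports.

Local Open Scope set_scope.

(** * Primes up to n and the reserved labels *)

(** The vertex [i] of ['I_n] stands for its initial label [i.+1]; the sets of
    labels below are therefore sets of vertices. *)
Definition prime_labels n : {set 'I_n} := [set i : 'I_n | prime i.+1].
Definition multiples n (q : nat) : {set 'I_n} := [set i : 'I_n | q %| i.+1].
Definition reserved n (P : {set 'I_n}) : {set 'I_n} :=
  [set i : 'I_n | (val i == 0%N) || [exists q in P, q.+1 %| i.+1]]%N.

(** Kummer's bound: in Legendre's formula the power [q ^ i] contributes
    [n %/ q ^ i - k %/ q ^ i - (n - k) %/ q ^ i] to the exponent of [q]; this is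
    at most 1, and it is 0 as soon as [q ^ i] exceeds [n]. *)
Lemma expn_logn_bin_le n k q : (0 < n)%N -> (k <= n)%N -> prime q ->
  (q ^ logn q 'C(n, k) <= n)%N.
Proof.
move=> n0 kn pq.
suff: (logn q 'C(n, k) <= trunc_log q n)%N.
  move=> le; apply: leq_trans (trunc_logP (prime_gt1 pq) n0).
  by rewrite leq_exp2l // prime_gt1.
have factE j : (j <= n)%N -> logn q j`! = (\sum_(1 <= i < n.+1) j %/ q ^ i)%N.
  move=> jn; rewrite logn_fact // [RHS](big_cat_nat (n := j.+1)) //=.
  rewrite [X in _ = _ + X]big1_seq ?addn0 // => i.
  rewrite mem_index_iota => /and3P[_ ji _].
  by rewrite divn_small // (leq_trans ji) // ltnW // ltn_expl // prime_gt1.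
have := congr1 (logn q) (bin_fact kn).
rewrite !lognM ?muln_gt0 ?fact_gt0 ?bin_gt0 // !factE ?leq_subr // => eqC.
have : (\sum_(1 <= i < n.+1) n %/ q ^ i <=
  \sum_(1 <= i < n.+1) (k %/ q ^ i + (n - k) %/ q ^ i + (i <= trunc_log q n)))%N.
  apply: leq_sum => i _; have qi0 : (0 < q ^ i)%N by rewrite expn_gt0 prime_gt0.
  have [le|lt] := leqP i (trunc_log q n).
    rewrite -{1}(subnKC kn) divnD // leq_add2l; exact: leq_b1.
  rewrite divn_small // ltnNge; apply: contraL lt => qin.
  by rewrite -leqNgt; exact: trunc_log_max (prime_gt1 pq) qin.
rewrite !big_split /= -eqC addnC leq_add2l => /leq_trans; apply.
have Tn : (trunc_log q n <= n)%N.
  apply: leq_trans (trunc_logP (prime_gt1 pq) n0).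
  by rewrite ltnW // ltn_expl // prime_gt1.
rewrite (big_cat_nat (n := (trunc_log q n).+1)) //=.
rewrite [X in _ + X]big1_seq ?addn0; last first.
  by move=> i; rewrite mem_index_iota => /and3P[_ Ti _]; rewrite leqNgt Ti.
rewrite (leq_trans (n := \sum_(1 <= i < (trunc_log q n).+1) 1)%N) //.
  by apply: leq_sum => i _; exact: leq_b1.
by rewrite sum_nat_const_nat subn1 muln1.
Qed.

Lemma prod_primes_logn m : (0 < m)%N -> m = (\prod_(q <- primes m) q ^ logn q m)%N.
Proof. by move=> m0; rewrite {1}(prod_prime_decomp m0) prime_decompE big_map. Qed.

Lemma pow2_size_primes m : (0 < m)%N -> (2 ^ size (primes m) <= m)%N.
Proof.
move=> m0; rewrite [leqRHS](prod_primes_logn m0).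
have : {in primes m, forall q, (1 < q ^ logn q m)%N}.
  move=> q qm; have := qm; rewrite mem_primes => /and3P[pq _ _].
  apply: leq_trans (prime_gt1 pq) _.
  by rewrite -{1}(expn1 q) leq_exp2l ?prime_gt1 // logn_gt0.
elim: (primes m) => [|q s IH] s2; rewrite ?big_nil // big_cons expnS.
apply: leq_mul; first by rewrite s2 ?mem_head.
by apply: IH => r rs; rewrite s2 // inE rs orbT.
Qed.

Lemma bin_le_expn_primes n k : (k <= n)%N -> ('C(n, k) <= n ^ #|prime_labels n|)%N.
Proof.
move=> kn; have C0 : (0 < 'C(n, k))%N by rewrite bin_gt0.
have [n0|n0] := posnP n.
  move: kn; rewrite n0 leqn0 => /eqP ->; rewrite bin0 expn_gt0 /= cards_eq0.
  by apply/eqP/setP => -[].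
have lefac q : q \in primes 'C(n, k) -> (q ^ logn q 'C(n, k) <= n)%N.
  by rewrite mem_primes => /and3P[pq _ _]; exact: expn_logn_bin_le.
rewrite {1}(prod_primes_logn C0).
apply: (@leq_trans (n ^ size (primes 'C(n, k)))).
  elim: (primes _) lefac => [|q s IH] sn; rewrite ?big_nil // big_cons expnS.
  apply: leq_mul; first by rewrite sn ?mem_head.
  by apply: IH => r rs; rewrite sn // inE rs orbT.
rewrite leq_pexp2l // cardE -(size_map (fun i : 'I_n => i.+1)).
apply: uniq_leq_size (primes_uniq _) _ => q qC.
have := lefac _ qC; move: (qC); rewrite -logn_gt0 => l0 qln.
move: qC; rewrite mem_primes => /and3P[pq _ _].
have qn : (q <= n)%N.
  by apply: leq_trans qln; rewrite -{1}(expn1 q) leq_exp2l ?prime_gt1.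
have qn' : (q.-1 < n)%N by rewrite prednK // prime_gt0.
apply/mapP; exists (Ordinal qn'); last by rewrite /= prednK // prime_gt0.
by rewrite mem_enum inE /= prednK // prime_gt0.
Qed.

Lemma expn2_le_central_bin m : (2 ^ m <= 'C(m.*2, m))%N.
Proof.
elim: m => // m IH; rewrite doubleS binS expnS mul2n -addnn.
have le : ('C(m.*2, m) <= 'C(m.*2.+1, m.+1))%N by rewrite binS leq_addl.
rewrite leq_add // (leq_trans IH) //.
by rewrite leq_bin2l.
Qed.

(** A central binomial coefficient is exponentially large, yet each prime up to
    [n] contributes at most [n] to it: so there are at least about [n / ln n]
    primes. *)
Lemma chebyshev n : (2 ^ n./2 <= n ^ #|prime_labels n|)%N.
Proof.
apply: leq_trans (expn2_le_central_bin _) _.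
have le : (n./2.*2 <= n)%N by rewrite -{2}(odd_double_half n) leq_addl.
apply: leq_trans (leq_bin2l _ le) _; apply: bin_le_expn_primes.
by apply: leq_trans le; rewrite -addnn leq_addl.
Qed.

Lemma card_multiples n q : #|multiples n q| = (n %/ q)%N.
Proof.
rewrite divn_count_dvd big_add1 big_mkord -sum1_card big_mkcond /=.
by apply: eq_bigr => i _; rewrite inE; case: (_ %| _)%N.
Qed.

(** With [k] a 25th of the number of primes, at most [24 * k] primes are at most
    [24 * k], so [k] larger ones can be kept; each has at most [n / (24 * k)]
    multiples, whence at most [n / 24] multiples in total. *)
Lemma reserve_primes n : exists P : {set 'I_n},
  [/\ P \subset prime_labels n, #|P| = (#|prime_labels n| %/ 25)%N
    & (#|reserved P| <= 1 + n %/ 24)%N].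
Proof.
set k := (_ %/ 25)%N.
pose L := [set i in prime_labels n | (24 * k <= i)%N].
have kL : (k <= #|L|)%N.
  have : (#|prime_labels n| <= 24 * k + #|L|)%N.
    rewrite -(cardsID L (prime_labels n)) addnC leq_add //; last first.
      by rewrite subset_leq_card // subsetIr.
    apply: (@leq_trans #|[set i : 'I_n | (i < 24 * k)%N]|).
      apply/subset_leq_card; apply/fintype.subsetP => i; rewrite !inE ltnNge.
      by case: (prime _) => //=; rewrite andbT.
    rewrite cardE -(size_map val) -[leqRHS](size_iota 0).
    apply: uniq_leq_size => [|x /mapP[i]].
      by rewrite map_inj_uniq ?enum_uniq //; exact: val_inj.
    by rewrite mem_enum inE mem_iota => ? ->.
  rewrite /k; lia.
have [s [us sk sL]] := card_geqP kL.
have cP : #|[set x in s]| = k by rewrite cardsE (card_uniqP us).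
exists [set x in s]; split => //.
  by apply/fintype.subsetP => i; rewrite inE => /sL; rewrite !inE => /andP[].
set P := [set x in s] in cP *.
have sub : reserved P \subset
    [set i : 'I_n | val i == 0%N] :|: \bigcup_(q in P) multiples n q.+1.
  apply/fintype.subsetP => i; rewrite !inE => /orP[-> //|/existsP[q /andP[qP qi]]].
  by apply/orP; right; apply/bigcupP; exists q => //; rewrite inE.
apply: leq_trans (subset_leq_card sub) _.
apply: leq_trans (leq_card_setU _ _) _; apply: leq_add.
  apply/card_le1_eqP => i j; rewrite !inE => /eqP i0 /eqP j0.
  by apply: val_inj; rewrite i0 j0.
apply: (@leq_trans (\sum_(q in P) n %/ q.+1)%N).
  elim/big_rec2: _ => [|q m S _ IH]; first by rewrite cards0.
  by apply: leq_trans (leq_card_setU _ _) _; rewrite card_multiples leq_add2l.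
have [k0|k0] := posnP k.
  by rewrite big1 // => q; move/eqP: cP; rewrite k0 cards_eq0 => /eqP ->; rewrite inE.
apply: (@leq_trans (\sum_(q in P) n %/ (24 * k))%N).
  apply: leq_sum => q; rewrite inE => /sL; rewrite !inE => /andP[_ le].
  by apply: leq_div2l; [rewrite muln_gt0 | exact: ltnW].
by rewrite sum_nat_const cP divnMA mulnC leq_trunc_div.
Qed.

(** * Repairing a labeling *)

(** Induction on the number of points of [U] outside [P]: exchanging such a
    point [u] with a point [x] of [P] outside [U] reduces to [U] with [u]
    replaced by [x]. *)
Lemma injection_into (T : finType) (U P : {set T}) : #|U| <= #|P| ->
  exists s : T -> T, [/\ injective s, forall u, u \in U -> s u \in P
    & forall x, x \notin U -> x \notin P -> s x = x].
Proof.
have [m] := ubnP #|U :\: P|; elim: m U => // m IH U Um UP.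
have [/eqP UP0|[u uU]] := set_0Vmem (U :\: P).
  by exists id; split => // u uU; apply: fintype.subsetP uU; rewrite -finset.setD_eq0.
move: (uU); rewrite inE => /andP[uNP u_U].
have [x] : exists x, x \in P :\: U.
  apply/set0Pn; rewrite -card_gt0; apply: contraLR UP.
  rewrite -leqNgt leqn0 cards_eq0 finset.setD_eq0 => PU.
  by rewrite -ltnNge proper_card //; apply/fintype.properP; split => //; exists u.
rewrite inE => /andP[xNU xP].
have xu : x != u by apply: contraNneq xNU => ->.
pose U' := x |: (U :\ u).
have cU' : #|U'| = #|U|.
  by rewrite cardsU1 !inE (negbTE xNU) andbF (cardsD1 u U) u_U.
have [||s [s_inj sU s_id]] := IH U'; rewrite ?cU' //.
  move: Um; rewrite ltnS (cardsD1 u) uU add1n; apply: leq_trans.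
  rewrite ltnS; apply/subset_leq_card/fintype.subsetP => y; rewrite !inE.
  by case: eqP => [->|_] /=; [rewrite xP | case: (y \in P)].
exists (s \o tperm u x); split.
- exact: inj_comp s_inj perm_inj.
- move=> y yU /=; have [->|yu] := eqVneq y u.
    by rewrite tpermL sU // !inE eqxx.
  have yx : y != x by apply: contraNneq xNU => <-.
  by rewrite tpermD 1?eq_sym // sU // !inE yu yU orbT.
- move=> y yU yP /=.
  have yx : y != x by apply: contraNneq yP => ->.
  have yu : y != u by apply: contraNneq yU => ->.
  by rewrite tpermD 1?eq_sym // s_id // !inE negb_or yx /= yu.
Qed.

Definition bad n (G : sgraph 'I_n) (P : {set 'I_n}) : {set 'I_n} :=
  [set v | (1 < degree G v) &&
    (\big[gcdn/0]_(u in nbhd G v :\: reserved P) u.+1 != 1)].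

Lemma biggcdn_eq1 (T : finType) (A : {set T}) (f : T -> nat) (x y : T) :
  x \in A -> y \in A -> coprime (f x) (f y) -> \big[gcdn/0]_(u in A) f u = 1.
Proof.
move=> xA yA /eqP xy; apply/eqP; rewrite -dvdn1 -xy dvdn_gcd.
by rewrite (@biggcdn_inf _ _ _ _ _ xA) // (@biggcdn_inf _ _ _ _ _ yA).
Qed.

(** The deterministic half of the argument: each bad vertex consumes two of the
    primes of [P], and the relabeling spoils no other vertex because reserved
    neighbors were discarded in the definition of [bad]. *)
Lemma neighborhood_prime_few_bad n (G : sgraph 'I_n) (P : {set 'I_n}) :
  P \subset prime_labels n -> 2 * #|bad G P| <= #|P| -> neighborhood_prime G.
Proof.
move=> Pprime badP.
have PW : P \subset reserved P.
  apply/fintype.subsetP => q qP; rewrite inE; apply/orP; right.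
  by apply/existsP; exists q; rewrite qP dvdnn.
have Pp q : q \in P -> prime q.+1.
  by move/(fintype.subsetP Pprime); rewrite inE.
have Pcop q r : q \in P -> r \in P -> q != r -> coprime q.+1 r.+1.
  move=> qP rP qr; rewrite prime_coprime ?Pp // dvdn_prime2 ?Pp //.
have /choice[uu uuP] : forall v, exists xy : 'I_n * 'I_n, v \in bad G P ->
    [/\ xy.1 \in nbhd G v, xy.2 \in nbhd G v & xy.1 != xy.2].
  move=> v; have [|vN] := boolP (v \in bad G P); last by exists (v, v).
  by rewrite inE => /andP[/card_gt1P[x [y [? ? ?]]] _]; exists (x, y).
pose U := [set (uu v).1 | v in bad G P] :|: [set (uu v).2 | v in bad G P].
have U1 v : v \in bad G P -> (uu v).1 \in U.
  by move=> vB; apply/finset.setUP; left; apply/imsetP; exists v.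
have U2 v : v \in bad G P -> (uu v).2 \in U.
  by move=> vB; apply/finset.setUP; right; apply/imsetP; exists v.
have [|s [s_inj sU s_id]] := @injection_into _ U P.
  apply: leq_trans badP; rewrite mul2n -addnn.
  by apply: leq_trans (leq_card_setU _ _) _; rewrite leq_add // leq_imset_card.
exists (fun i => (s i).+1); split.
- by move=> i j [] /val_inj /s_inj.
- move=> k; rewrite card_ord; split => [/andP[k0 kn]|[v <-]]; last by rewrite ltn_ord.
  have kn' : k.-1 < n by rewrite prednK.
  exists (invF s_inj (Ordinal kn')); by rewrite f_invF /= prednK.
move=> v dv; have [[u uN uU]|NU] := pselect (exists2 u, u \in nbhd G v & u \in U).
  (* [u] carries a prime of [P]: it suffices to find a second neighbor that
     carries another such prime or an unchanged, non-reserved label. *)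
  suff [w wN [wu|wu]] : exists2 w, w \in nbhd G v &
    (w \in U /\ u != w) \/ (w \notin U /\ w \notin reserved P).
  - apply: (biggcdn_eq1 uN wN); apply: Pcop; rewrite ?sU //; first by case: wu.
    by rewrite (inj_eq s_inj); case: wu.
  - apply: (biggcdn_eq1 uN wN); case: wu => wU wW.
    rewrite prime_coprime ?Pp ?sU // (s_id w) //; last first.
      by apply: contra wW; exact: fintype.subsetP.
    apply: contra wW => dvd; rewrite inE; apply/orP; right; apply/existsP.
    by exists (s u); rewrite sU.
  have [vB|vB] := boolP (v \in bad G P).
    have [N1 N2 neq] := uuP _ vB.
    have [e|ne] := eqVneq u (uu v).1; last first.
      by exists (uu v).1 => //; left; rewrite U1.
    by exists (uu v).2 => //; left; rewrite U2 // e.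
  move: vB; rewrite inE dv /= negbK => /eqP g1.
  have [w] : exists w, w \in nbhd G v :\: reserved P :\ u.
    (* Otherwise [u] is the only candidate; gcd 1 forces its label to be 1,
       which is reserved, so the gcd is an empty one, that is 0. *)
    apply/set0Pn/negP => /eqP e0.
    have onlyu i : i \in nbhd G v :\: reserved P -> i = u.
      move=> iN; apply/eqP; apply: contraT => iu.
      by move/setP/(_ i): e0; rewrite !inE iu /=; move: iN; rewrite !inE => ->.
    have dvd1 m : (forall i, i \in nbhd G v :\: reserved P -> m %| i.+1) -> m = 1.
      by move=> dvd; apply/eqP; rewrite -dvdn1 -g1; apply/dvdn_biggcdP.
    have /eqP : u.+1 = 1 by apply: dvd1 => i /onlyu ->.
    rewrite eqSS => u0; suff: 2 = 1 by [].
    apply: dvd1 => i iN; move: (iN).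
    by rewrite (onlyu _ iN) inE inE /= u0.
  rewrite !inE => /and3P[wu wW wN]; exists w; first by rewrite inE.
  have [wU|wU] := boolP (w \in U); last by right; split=> //; rewrite inE.
  by left; split => //; rewrite eq_sym.
have vB : v \notin bad G P.
  apply/negP => vB; apply: NU; have [N1 _ _] := uuP _ vB.
  by exists (uu v).1 => //; exact: U1.
move: vB; rewrite inE dv /= negbK => /eqP g1.
apply/eqP; rewrite -dvdn1 -g1; apply/dvdn_biggcdP => u.
rewrite inE => /andP[uW uN].
have uP : u \notin P by apply: contra uW; exact: fintype.subsetP.
have uU : u \notin U by apply/negP => uU; apply: NU; exists u.
have su_u : (s u).+1 %| u.+1 by rewrite s_id.
exact: (@biggcdn_inf _ u _ _ _ uN su_u).
Qed.

(** * Cylinder events of G(n, p) *)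

Local Open Scope ring_scope.

(** Expanding the product over pairs chooses, pair by pair, between an edge and
    a non-edge: this is the independence of the edges.  Pairs and other sets are
    put together by giving the summands 0 and 1 to a set that is not a pair, so
    that no set of edges containing it contributes. *)
Lemma sum_sgraph_prod (R : comNzRingType) n (a b : {set 'I_n} -> R) :
  \sum_(G : sgraph 'I_n) \prod_(e : {set 'I_n} | #|e| == 2%N)
    (if e \in edges G then a e else b e) =
  \prod_(e : {set 'I_n} | #|e| == 2%N) (a e + b e).
Proof.
have -> : \prod_(e : {set 'I_n} | #|e| == 2%N) (a e + b e) =
    \prod_(e : {set 'I_n}) ((if #|e| == 2 then a e else 0) +
                            (if #|e| == 2 then b e else 1)).
  rewrite big_mkcond; apply: eq_bigr => e _.
  by case: (#|e| == 2%N) => //; rewrite add0r.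
rewrite bigA_distr; pose ok (J : {set {set 'I_n}}) := [forall e in J, #|e| == 2%N].
rewrite [RHS](bigID ok) /= [X in _ = _ + X]big1 ?addr0; last first.
  move=> J /forall_inPn[e eJ e2]; rewrite (bigD1 e) //= eJ (negbTE e2).
  by rewrite mul0r.
rewrite [RHS](reindex_omap (@edges 'I_n) insub) /=; last first.
  by move=> J okJ; rewrite insubT.
apply: eq_big => [G|G _].
  by rewrite /ok edges_card2 valK eqxx.
rewrite big_mkcond; apply: eq_bigr => e _.
have [|e2] := boolP (#|e| == 2%N) => //.
by case: ifP => // eG; move: (edges_card2 G) e2 => /forall_inP/(_ _ eG) ->.
Qed.

Lemma gnp_weight_sum (R : realType) n (p : R) :
  \sum_(G : sgraph 'I_n) gnp_weight p G = 1.
Proof.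
rewrite /gnp_weight sum_sgraph_prod big1 // => e _; by rewrite addrC subrK.
Qed.

(** Replacing [p] by 0 on the forbidden pairs and [1 - p] by 0 on the required
    ones in [sum_sgraph_prod] kills exactly the graphs outside the cylinder. *)
Lemma gnp_cylinder (R : realType) n (p : R) (A B : {set {set 'I_n}}) :
  {in A, forall e : {set 'I_n}, #|e| = 2%N} ->
  {in B, forall e : {set 'I_n}, #|e| = 2%N} ->
  [disjoint A & B] ->
  \sum_(G : sgraph 'I_n | (A \subset edges G) && [disjoint B & edges G])
     gnp_weight p G = p ^+ #|A| * (1 - p) ^+ #|B|.
Proof.
move=> A2 B2 AB.
transitivity (\prod_(e : {set 'I_n} | #|e| == 2%N)
   ((if e \in B then 0 else p) + (if e \in A then 0 else 1 - p))).
  rewrite -sum_sgraph_prod big_mkcond; apply: eq_bigr => G _.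
  case: ifPn => [/andP[AG BG]|].
    apply: eq_bigr => e e2; case: ifP => eG.
      by rewrite (disjointFl BG).
    by rewrite (contraFF (fintype.subsetP AG e)).
  rewrite negb_and => /orP[/fintype.subsetPn[e eA eG]|].
    by rewrite (bigD1 e) ?A2 //= (negbTE eG) eA mul0r.
  rewrite -finset.setI_eq0 => /set0Pn[e]; rewrite inE => /andP[eB eG].
  by rewrite (bigD1 e) ?B2 //= eG eB mul0r.
transitivity (\prod_(e : {set 'I_n} | #|e| == 2%N)
   ((if e \in A then p else 1) * (if e \in B then 1 - p else 1))).
  apply: eq_bigr => e _; case: ifPn => eB; case: ifPn => eA.
  - by rewrite (disjointFr AB eA) in eB.
  - by rewrite add0r mul1r.
  - by rewrite addr0 mulr1.
  - by rewrite mulr1 addrC subrK.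
have powE (D : {set {set 'I_n}}) (x : R) : {in D, forall e : {set 'I_n}, #|e| = 2%N} ->
    \prod_(e : {set 'I_n} | #|e| == 2%N) (if e \in D then x else 1) = x ^+ #|D|.
  move=> D2; rewrite -big_mkcondr -prodr_const.
  by apply: eq_bigl => e; apply: andb_idl => /D2 ->.
by rewrite big_split /= !powE.
Qed.

Lemma gnp_nbhd (R : realType) n (p : R) v (A S : {set 'I_n}) :
  v \notin A -> v \notin S -> [disjoint A & S] ->
  \sum_(G : sgraph 'I_n | (A \subset nbhd G v) && [disjoint S & nbhd G v])
     gnp_weight p G = p ^+ #|A| * (1 - p) ^+ #|S|.
Proof.
move=> vA vS AS; pose at_v u := [set u; v].
have at_v_inj (D : {set 'I_n}) : v \notin D -> {in D &, injective at_v}.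
  move=> vD u u' uD u'D /setP/(_ u); rewrite !inE eqxx /= => /esym/orP[/eqP //|/eqP uv].
  by rewrite uv (negbTE vD) in uD.
have at_v2 (D : {set 'I_n}) : v \notin D ->
    {in at_v @: D, forall e : {set 'I_n}, #|e| = 2%N}.
  move=> vD e /imsetP[u uD ->]; rewrite cards2; case: eqVneq => // uv.
  by rewrite uv (negbTE vD) in uD.
rewrite -(card_in_imset (at_v_inj _ vA)) -(card_in_imset (at_v_inj _ vS)).
rewrite -gnp_cylinder; [|exact: at_v2..|].
  apply: eq_bigl => G; congr andb.
    apply/fintype.subsetP/fintype.subsetP => [sub e /imsetP[u uA ->]|sub u uA].
      by have := sub _ uA; rewrite inE.
    by rewrite inE; apply: (sub (at_v u)); exact: imset_f.
  rewrite !disjoint_subset.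
  apply/fintype.subsetP/fintype.subsetP => [sub e /imsetP[u uA ->]|sub u uA].
    by have := sub _ uA; rewrite !inE.
  by have := sub (at_v u); rewrite imset_f // !inE; apply.
rewrite disjoint_subset; apply/fintype.subsetP => e /imsetP[u uA ->]; rewrite inE.
apply/imsetP => -[u' u'S] /setP/(_ u); rewrite !inE eqxx /= => /esym/orP[|] /eqP uu.
  by move: u'S; rewrite -uu (disjointFr AS uA).
by rewrite -uu uA in vA.
Qed.

(** * The expected number of bad vertices *)

Lemma gnp_weight_ge0 (R : realType) n (p : R) (G : sgraph 'I_n) :
  0 <= p <= 1 -> 0 <= gnp_weight p G.
Proof.
by move=> /andP[p0 p1]; apply: prodr_ge0 => e _; case: ifP; rewrite ?subr_ge0.
Qed.

(** The vertices that [v] must miss if all its non-reserved neighbors have labels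
    divisible by [q]. *)
Definition nonmultiples n (P : {set 'I_n}) (q : nat) (v : 'I_n) : {set 'I_n} :=
  (~: reserved P) :\: multiples n q :\ v.

Lemma notin_nbhd n (G : sgraph 'I_n) v : v \notin nbhd G v.
Proof.
rewrite inE finset.setUid; apply/negP => vG.
by have /forall_inP/(_ _ vG) := edges_card2 G; rewrite cards1.
Qed.

(** The gcd that makes [v] bad is either 0, when all neighbors are reserved, or
    at least 2, and then it has a prime divisor [q], which divides the label of
    some non-reserved neighbor [w].  Naming [w] is what keeps the union bound
    small: only the few prime divisors of [w.+1] have to be considered, and the
    edge to [w] brings a factor [p]. *)
Lemma card_bad_le n (G : sgraph 'I_n) (P : {set 'I_n}) :
  (#|bad G P| <= \sum_(v < n) (((finset.set0 \subset nbhd G v) &&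
       [disjoint ~: reserved P :\ v & nbhd G v])
    + \sum_(w < n) \sum_(q <- primes w.+1)
       (([set w] \subset nbhd G v) && [disjoint nonmultiples P q v & nbhd G v])))%N.
Proof.
rewrite -sum1_card big_mkcond /=; apply: leq_sum => v _.
rewrite inE; case: ifP => // /andP[_ g1]; rewrite finset.sub0set /=.
have [//|] := boolP [disjoint ~: reserved P :\ v & nbhd G v].
rewrite -finset.setI_eq0 => /set0Pn[w]; rewrite !inE add0n => /andP[/andP[wv wW] wN].
set g := (\big[gcdn/0]_(_ in _) _)%N in g1.
have gw : (g %| w.+1)%N.
  by apply: (@biggcdn_inf _ w _ _ _ _ (dvdnn _)); rewrite !inE wW.
have g0 : (0 < g)%N by exact: dvdn_gt0 gw.
have g_gt1 : (1 < g)%N by rewrite ltn_neqAle eq_sym g1.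
have qw : pdiv g \in primes w.+1.
  by rewrite mem_primes pdiv_prime //= (dvdn_trans (pdiv_dvd g)).
rewrite (bigD1 w) //= (big_rem _ qw) /= finset.sub1set inE wN /=.
suff -> : [disjoint nonmultiples P (pdiv g) v & nbhd G v] by [].
rewrite -finset.setI_eq0; apply/eqP/setP => u; rewrite [RHS]inE.
apply/negP => /finset.setIP[].
rewrite inE finset.in_set1 inE finset.in_setC => /and3P[_ uq uW] uN.
move/negP: uq; apply; rewrite inE; apply: dvdn_trans (pdiv_dvd g) _.
by apply: (@biggcdn_inf _ u _ _ _ _ (dvdnn _)); rewrite inE uW.
Qed.

(** Linearity of expectation over [card_bad_le]; a label at most [n] has at most
    [trunc_log 2 n] prime divisors. *)
Lemma expected_card_bad_le (R : realType) n (p : R) (P : {set 'I_n}) s :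
  0 <= p <= 1 -> (forall q v, prime q -> s <= #|nonmultiples P q v|)%N ->
  \sum_(G : sgraph 'I_n) gnp_weight p G * #|bad G P|%:R <=
  n%:R * ((1 - p) ^+ s * (1 + n%:R * (trunc_log 2 n)%:R * p)).
Proof.
move=> p01 hs; have w0 G := @gnp_weight_ge0 R n p G p01.
have indE (b : pred (sgraph 'I_n)) :
    \sum_G gnp_weight p G * (b G)%:R = \sum_(G | b G) gnp_weight p G.
  by rewrite [RHS]big_mkcond; apply: eq_bigr => G _; case: (b G); rewrite ?mulr1 ?mulr0.
have powle m : (s <= m)%N -> (1 - p) ^+ m <= (1 - p) ^+ s.
  by case/andP: p01 => p0 p1 sm; apply: ler_wiXn2l; rewrite ?subr_ge0 // gerBl.
have pow0 : 0 <= (1 - p) ^+ s by rewrite exprn_ge0 // subr_ge0; case/andP: p01.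
pose b0 v (G : sgraph 'I_n) := (finset.set0 \subset nbhd G v) &&
  [disjoint ~: reserved P :\ v & nbhd G v].
pose b1 v w q (G : sgraph 'I_n) :=
  ([set w] \subset nbhd G v) && [disjoint nonmultiples P q v & nbhd G v].
have le0 v : \sum_(G | b0 v G) gnp_weight p G <= (1 - p) ^+ s.
  rewrite gnp_nbhd ?inE ?eqxx //; last by rewrite -finset.setI_eq0 finset.set0I.
  rewrite cards0 mul1r; apply/powle/(leq_trans (hs 2%N v isT)).
  by apply/subset_leq_card/finset.setSD/finset.subsetDl.
have le1 v (w : 'I_n) q : q \in primes w.+1 ->
    \sum_(G | b1 v w q G) gnp_weight p G <= p * (1 - p) ^+ s.
  rewrite mem_primes => /and3P[pq _ qw].
  have [<-|wv] := eqVneq w v.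
    rewrite big1 ?mulr_ge0 //; first by case/andP: p01.
    by move=> G; rewrite /b1 finset.sub1set (negbTE (notin_nbhd _ _)).
  rewrite gnp_nbhd ?inE ?eqxx //; last 2 first.
  - by rewrite eq_sym.
  - by rewrite finset.disjoints_subset finset.sub1set !inE qw /= andbF.
  rewrite cards1 expr1; apply: ler_wpM2l; first by case/andP: p01.
  by apply/powle/hs.
apply: (@le_trans _ _ (\sum_(v < n) (\sum_(G | b0 v G) gnp_weight p G +
    \sum_(w < n) \sum_(q <- primes w.+1) \sum_(G | b1 v w q G) gnp_weight p G))).
  apply: (@le_trans _ _ (\sum_(G : sgraph 'I_n) gnp_weight p G *
     (\sum_(v < n) (b0 v G + \sum_(w < n) \sum_(q <- primes w.+1) b1 v w q G))%N%:R)).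
    by apply: ler_sum => G _; rewrite ler_wpM2l // ler_nat card_bad_le.
  rewrite le_eqVlt; apply/orP; left; apply/eqP.
  under eq_bigr do rewrite natr_sum mulr_sumr.
  rewrite exchange_big; apply: eq_bigr => v _.
  under eq_bigr do rewrite natrD mulrDr natr_sum mulr_sumr.
  rewrite big_split /= indE; congr (_ + _).
  rewrite exchange_big; apply: eq_bigr => w _.
  under eq_bigr do rewrite natr_sum mulr_sumr.
  by rewrite exchange_big; apply: eq_bigr => q _; rewrite indE.
rewrite -[X in _ <= X%:R * _](card_ord n) mulr_natl -sumr_const.
apply: ler_sum => v _; rewrite mulrDr mulr1 lerD //.
rewrite mulrC -!mulrA -[X in _ <= X%:R * _](card_ord n) mulr_natl -sumr_const.
apply: ler_sum => w _.
apply: (@le_trans _ _ (\sum_(q <- primes w.+1) p * (1 - p) ^+ s)).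
  by rewrite big_seq [leRHS]big_seq; apply: ler_sum => q qw; exact: le1.
rewrite big_const_seq count_predT iter_addr_0 -[leLHS]mulr_natl.
rewrite ler_wpM2r //; first by rewrite mulr_ge0 //; case/andP: p01.
rewrite ler_nat trunc_log_max // (leq_trans (pow2_size_primes _)) //.
Qed.

(** Markov's inequality for [#|bad G P|], since a graph that is not
    neighborhood-prime has more than [#|P| / 2] bad vertices. *)
Lemma gnp_fail_markov (R : realType) n (p : R) (P : {set 'I_n}) s :
  0 <= p <= 1 -> P \subset prime_labels n ->
  (forall q v, prime q -> s <= #|nonmultiples P q v|)%N ->
  #|P|%:R * (1 - gnp_prob p (@neighborhood_prime 'I_n)) <=
  2 * (n%:R * ((1 - p) ^+ s * (1 + n%:R * (trunc_log 2 n)%:R * p))).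
Proof.
move=> p01 Pp hs; have w0 G := @gnp_weight_ge0 R n p G p01.
have tot := gnp_weight_sum n p.
have -> : 1 - gnp_prob p (@neighborhood_prime 'I_n) =
    \sum_(G : sgraph 'I_n | ~~ `[< neighborhood_prime G >]) gnp_weight p G.
  rewrite -tot [X in X - _](bigID
    (fun G : sgraph 'I_n => `[< neighborhood_prime G >])) /=.
  by rewrite [X in X - _]addrC addrK.
apply: le_trans (ler_wpM2l _ (expected_card_bad_le p01 hs)) => //.
rewrite !mulr_sumr [leRHS](bigID
  (fun G : sgraph 'I_n => `[< neighborhood_prime G >])) /=.
apply: ler_wpDl; first by apply: sumr_ge0 => G _; rewrite !mulr_ge0.
apply: ler_sum => G /asboolPn NG; rewrite mulrCA [leLHS]mulrC ler_wpM2l //.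
rewrite -natrM ler_nat leqNgt; apply/negP => /ltnW bP.
by apply: NG; apply: neighborhood_prime_few_bad Pp bP.
Qed.

(** The worst prime is [q = 2], whose multiples are half of all labels. *)
Lemma card_nonmultiples_ge n (P : {set 'I_n}) q v :
  (#|reserved P| <= 1 + n %/ 24)%N -> prime q ->
  (n - n %/ 2 - n %/ 24 - 2 <= #|nonmultiples P q v|)%N.
Proof.
move=> W pq; have Mq : (n %/ q <= n %/ 2)%N by rewrite leq_div2l ?prime_gt1.
have c4 := cardsC (reserved P); rewrite card_ord in c4.
set A := ~: reserved P in c4; set M := multiples n q.
have c1 := cardsD1 v (A :\: M); have c2 := cardsD A M.
have c3 : (#|A :&: M| <= n %/ q)%N.
  by rewrite -card_multiples subset_leq_card // finset.subsetIr.
rewrite /nonmultiples -/A -/M; have := leq_b1 (v \in A :\: M).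
move: c1 c2 c3 c4 Mq W; move: (nat_of_bool _) (n %/ q)%N.
move: #|A :\: M :\ v| #|A :\: M| #|A :&: M| #|A| #|reserved P|.
lia.
Qed.

(** * Asymptotics *)

Lemma ln2_ge_half (R : realType) : 2^-1 <= ln (2 : R).
Proof.
rewrite -ler_expR lnK ?posrE // -[leRHS]invrK -[leLHS]invrK -expRN.
rewrite lef_pV2 ?posrE ?invr_gt0 ?expR_gt0 //.
by apply: le_trans (expR_ge1Dx _); lra.
Qed.

Lemma ln_le_of_expn_le (R : realType) (a b c : nat) : (0 < c)%N ->
  (2 ^ a <= c ^ b)%N -> (a%:R : R) <= 2 * (b%:R * ln c%:R).
Proof.
move=> c0; rewrite -(ler_nat R) !natrX => le.
have : ln (2 ^+ a : R) <= ln (c%:R ^+ b) by rewrite ler_ln ?posrE ?exprn_gt0 // ltr0n.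
rewrite !lnXn ?ltr0n // -[X in X <= _]mulr_natl -[X in _ <= X]mulr_natl.
have := ln2_ge_half R; have : (0 : R) <= a%:R by rewrite ler0n.
nra.
Qed.

(** Here [x] and [t] stand for [ln n] and [n p].  The factor [1 + 2 * x * t] is
    at most [3 * t ^+ 2], so the term of degree 5 of the exponential series
    leaves a decay of order 3: one power of [x] will absorb [n / #|P|], of
    order [x], and any further one makes the bound tend to 0. *)
Lemma exp_decay (R : realType) : exists2 C : R, 0 < C &
  forall x t, 1 <= x -> x <= t ->
    expR (- (t / 3)) * (1 + 2 * x * t) <= C / x ^+ 3.
Proof.
exists (3 * 3 ^+ 5 * 5`!%:R).
  by apply: mulr_gt0; [lra | rewrite ltr0n fact_gt0].
move=> x t x1 xt; have t0 : 0 < t by lra.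
have := @expR_ge1Dxn R (t / 3) 4 ltac:(lra).
set E := expR (t / 3); set c := (5`!%:R : R) => le.
have c0 : 0 < c by rewrite ltr0n fact_gt0.
have E0 : 0 < E by exact: expR_gt0.
have {}le : t ^+ 5 <= 3 ^+ 5 * c * E.
  have : (t / 3) ^+ 5 / c <= E by lra.
  rewrite ler_pdivrMr // expr_div_n ler_pdivrMr ?exprn_gt0 //.
  by rewrite [E * c]mulrC [_ * 3 ^+ 5]mulrC mulrA.
have x3 : 0 < x ^+ 3 by apply: exprn_gt0; lra.
rewrite expRN -/E ler_pdivlMr //.
rewrite -[leLHS]mulrA ler_pdivrMl //.
apply: (@le_trans _ _ (3 * t ^+ 2 * t ^+ 3)).
  apply: ler_pM; rewrite ?exprn_ge0 //; [nra|lra|nra|].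
  by rewrite lerXn2r ?nnegrE //; lra.
have -> : 3 * t ^+ 2 * t ^+ 3 = 3 * t ^+ 5 by ring.
have -> : E * (3 * 3 ^+ 5 * c) = 3 * (3 ^+ 5 * c * E) by ring.
by rewrite ler_pM2l.
Qed.

Lemma gnp_prob_le1 (R : realType) n (p : R) (A : sgraph 'I_n -> Prop) :
  0 <= p <= 1 -> gnp_prob p A <= 1.
Proof.
move=> p01; rewrite -(gnp_weight_sum n p) /gnp_prob.
rewrite [leRHS](bigID (fun G => `[< A G >])) /= lerDl.
by apply: sumr_ge0 => G _; apply: gnp_weight_ge0.
Qed.

(** The bound 500 serves to make [x = ln n] negligible against [n], through
    [x ^+ 2 / 2 <= n]: the rounding in [#|P|] then costs a factor 2, and
    [n <= 250 * #|P| * x]. *)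
Lemma gnp_fail_le (R : realType) : exists2 C : R, 0 < C &
  forall n (p : R), 0 <= p <= 1 -> 500 <= ln n%:R :> R -> ln n%:R <= n%:R * p ->
    1 - gnp_prob p (@neighborhood_prime 'I_n) <= C / ln n%:R.
Proof.
have [C C0 decay] := exp_decay R; exists (500 * C); first by apply: mulr_gt0 C0; lra.
move=> n p; set x := ln n%:R => p01 x500 xt; have [p0 p1] := andP p01.
have n0 : (0 < n)%N.
  by rewrite lt0n; apply/eqP => n0; move: x500; rewrite /x n0 ln0 //; lra.
have nE : n%:R = expR x by rewrite lnK // posrE ltr0n.
have nx : x ^+ 2 / 2 <= n%:R.
  by have := @expR_ge1Dxn R x 1 ltac:(lra); rewrite -nE (_ : 2`! = 2)%N //; lra.
have n500 : (500 <= n)%N.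
  rewrite -(ler_nat R); nra.
have [P [Pp cP cW]] := reserve_primes n.
pose s := (n - n %/ 2 - n %/ 24 - 2)%N.
have hs q v : prime q -> (s <= #|nonmultiples P q v|)%N by exact: card_nonmultiples_ge.
have := gnp_fail_markov p01 Pp hs.
set f := 1 - _; set k := #|P|; set l := trunc_log 2 n => main.
have kx : n%:R <= 250 * (k%:R * x).
  have := ln_le_of_expn_le R n0 (chebyshev n); rewrite -/x.
  have n2 : n%:R <= 2 * n./2%:R + 1 :> R.
    by rewrite -natrM natr1 ler_nat; clear; lia.
  have pik : #|prime_labels n|%:R <= 25 * k%:R + 24 :> R.
    rewrite -natrM -natrD ler_nat /k cP.
    by move: #|prime_labels n|; clear; lia.
  nra.
have lx : l%:R <= 2 * x.
  have := @ln_le_of_expn_le R l 1 n n0; rewrite mul1r expn1; apply.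
  exact: trunc_logP.
have ns : n%:R <= 3 * s%:R :> R.
  by rewrite -natrM ler_nat /s; move: n500; clear; lia.
have pow : (1 - p) ^+ s <= expR (- (n%:R * p / 3)).
  apply: (@le_trans _ _ (expR (- p) ^+ s)).
    by rewrite lerXn2r ?nnegrE ?subr_ge0 ?expR_ge0 //; exact: expR_ge1Dx.
  rewrite -expRM_natl ler_expR; nra.
have F : (1 - p) ^+ s * (1 + n%:R * l%:R * p) <= C / x ^+ 3.
  apply: le_trans (decay _ _ _ xt); last lra.
  apply: ler_pM => //; rewrite ?exprn_ge0 ?subr_ge0 //.
    by rewrite addr_ge0 // !mulr_ge0.
  have np0 : 0 <= n%:R * p by rewrite mulr_ge0.
  by rewrite lerD2l mulrAC mulrC ler_wpM2r.
have k0 : 0 < k%:R :> R.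
  have : 0 < n%:R :> R by rewrite ltr0n.
  have : 0 <= k%:R :> R by rewrite ler0n.
  nra.
rewrite -(ler_pM2l k0); apply: le_trans main _.
apply: (@le_trans _ _ (2 * (250 * (k%:R * x) * (C / x ^+ 3)))).
  rewrite ler_wpM2l // ler_pM // mulr_ge0 ?exprn_ge0 ?subr_ge0 //.
  by rewrite addr_ge0 // !mulr_ge0.
have -> : 2 * (250 * (k%:R * x) * (C / x ^+ 3)) = k%:R * (500 * C / x) * x^-1.
  by field; lra.
have x0 : 0 < x by lra.
apply: ler_piMr; last by rewrite invf_le1; lra.
apply: mulr_ge0; first exact: ltW.
by apply: divr_ge0; [apply: mulr_ge0; lra | lra].
Qed.

Local Open Scope classical_set_scope.

Theorem theorem25 (R : realType) (p g : nat -> R)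
  (p01 : forall n : nat, 0 <= p n <= 1)
  (g_omega1 : g n @[n --> \oo] --> +oo)
  (p_gt : \forall n \near \oo,
    (ln n%:R + ln (ln n%:R) + g n) / n%:R < p n) :
  gnp_prob (p n) (fun G : sgraph 'I_n => neighborhood_prime G)
    @[n --> \oo] --> (1 : R).
Proof.
apply/cvgrPdist_le => e e0.
have [C C0 fail_le] := gnp_fail_le R.
have g_ge0 : \forall n \near \oo, 0 <= g n by move/cvgryPge : g_omega1; apply.
near=> n.
have n_big : expR (500 + C / e) <= n%:R by near: n; exact: nbhs_infty_ger.
have n0 : 0 < n%:R :> R by apply: lt_le_trans n_big; exact: expR_gt0.
have x_big : 500 + C / e <= ln n%:R by rewrite -ler_expR lnK.
have Ce : 0 < C / e by rewrite divr_gt0.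
have x500 : 500 <= ln n%:R :> R by lra.
have x0 : 0 < ln n%:R :> R by lra.
have Cx : C / ln n%:R <= e by rewrite ler_pdivrMr // mulrC -ler_pdivrMr //; lra.
have xt : ln n%:R <= n%:R * p n.
  have : (ln n%:R + ln (ln n%:R) + g n) / n%:R < p n by near: n.
  rewrite ltr_pdivrMr // => /ltW; rewrite mulrC; apply: le_trans.
  have : 0 <= g n by near: n.
  have : 0 <= ln (ln n%:R : R) by rewrite ln_ge0 //; lra.
  lra.
rewrite ger0_norm ?subr_ge0 ?gnp_prob_le1 //; apply: le_trans Cx.
exact: fail_le.
Unshelve. all: by end_near. Qed.
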